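(* Let $k:=\lfloor \epsilon N\rfloor$, for each $p\in[P]$ let $q_p$ be the $(k+1)$-th largest value (counted with multiplicity) amongst $\{-\mathbf{b}_p^\top\boldsymbol{\xi}_i\}_{i\in[N]}$, and let $M>0$ be a sufficiently large constant (see context). Then the mixed-integer program \begin{align*} \min_{\mathbf{z},\mathbf{r},t,\mathbf{x}}\quad & \mathbf{c}^\top\mathbf{x}\\ \text{s.t.}\quad & \mathbf{z}\in\{0,1\}^N,\ t\ge0,\ \mathbf{r}\in\mathbb{R}^N,\ \mathbf{r}\ge\mathbf{0},\ \mathbf{x}\in\mathcal{X},\\ & \epsilon\, t \geq \theta + \frac{1}{N}\sum_{i\in[N]} r_i,\\ & M(1-z_i)\geq t-r_i, \quad i\in[N],\\ & \sum_{i\in[N]} z_i\leq k,\\ & \frac{\mathbf{b}_p^\top \boldsymbol{\xi}_i+d_p-\mathbf{a}_p^\top\mathbf{x}}{\|\mathbf{b}_p\|_*}+\frac{-\mathbf{b}_p^\top\boldsymbol{\xi}_i-q_p}{\|\mathbf{b}_p\|_*}\, z_i\geq t-r_i, \quad i\in[N],\ p\in[P], \end{align*} is an exact reformulation of $\min\{\mathbf{c}^\top\mathbf{x}:\mathbf{x}\in\mathcal{X}_{\mathrm{DR}}(\mathcal{S})\}$; that is, $\mathcal{X}_{\mathrm{DR}}(\mathcal{S})$ equals the set of $\mathbf{x}\in\mathcal{X}$ for which there exist $(\mathbf{z},\mathbf{r},t)$ such that $(\mathbf{z},\mathbf{r},t,\mathbf{x})$ satisfies all of the constraints of this mixed-integer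 program.
   Context: Notation: $[n]:=\{1,\dots,n\}$. Fix positive integers $K,L,N,P$, a compact set $\mathcal{X}\subset\mathbb{R}^L$, a cost vector $\mathbf{c}\in\mathbb{R}^L$, a norm $\|\cdot\|$ on $\mathbb{R}^K$ with dual norm $\|\cdot\|_*$, samples $\boldsymbol{\xi}_1,\dots,\boldsymbol{\xi}_N\in\mathbb{R}^K$, a risk tolerance $\epsilon\in(0,1)$ and a radius $\theta>0$. For $p\in[P]$ let $\mathbf{a}_p\in\mathbb{R}^L$, $\mathbf{b}_p\in\mathbb{R}^K\setminus\{\mathbf{0}\}$, $d_p\in\mathbb{R}$. For $\mathbf{x}\in\mathcal{X}$ the safety set is $$\mathcal{S}(\mathbf{x}):=\{\boldsymbol{\xi}\in\mathbb{R}^K:\ \mathbf{b}_p^\top\boldsymbol{\xi}+d_p-\mathbf{a}_p^\top\mathbf{x}>0,\ p\in[P]\}.$$ Let $\mathbb{P}_N$ be the empirical distribution on $\boldsymbol{\xi}_1,\dots,\boldsymbol{\xi}_N$ (mass $1/N$ on each sample). For distributions $\mathbb{P},\mathbb{P}'$ on $\mathbb{R}^K$, the 1-Wasserstein distance is $$d_W(\mathbb{P},\mathbb{P}'):=\inf_{\Pi}\{\mathbb{E}_{(\boldsymbol{\xi},\boldsymbol{\xi}')\sim\Pi}[\|\boldsymbol{\xi}-\boldsymbol{\xi}'\|]:\ \Pi\text{ has marginal distributions }\mathbb{P},\mathbb{P}'\},$$ and the ambiguity set is $\mathcal{F}_N(\theta):=\{\mathbb{P}: d_W(\mathbb{P}_N,\mathbb{P})\le\theta\}$.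 The feasible region of the distributionally robust chance-constrained program is $$\mathcal{X}_{\mathrm{DR}}(\mathcal{S}):=\Big\{\mathbf{x}\in\mathcal{X}:\ \sup_{\mathbb{P}\in\mathcal{F}_N(\theta)}\mathbb{P}[\boldsymbol{\xi}\notin\mathcal{S}(\mathbf{x})]\le\epsilon\Big\}.$$ ''$M$ sufficiently large'' means: $M>0$ and $M\ge |\mathbf{b}_p^\top\boldsymbol{\xi}_i+d_p-\mathbf{a}_p^\top\mathbf{x}|/\|\mathbf{b}_p\|_*$ for all $\mathbf{x}\in\mathcal{X}$, $i\in[N]$, $p\in[P]$. *)

(* Defs.v *)
From HB Require Import structures.
From mathcomp Require Import all_boot all_order all_algebra.
From mathcomp Require Import all_classical all_reals all_analysis.
Set Implicit Arguments.
Unset Strict Implicit.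
Unset Printing Implicit Defensive.
Import Order.TTheory GRing.Theory Num.Theory.
Import numFieldNormedType.Exports.
Local Open Scope classical_set_scope.
Local Open Scope ring_scope.

Definition dotp (R : realType) n (u v : 'cV[R]_n) : R := (u^T *m v) 0 0.

(** Nonnegativity and [nrm 0 = 0] follow from these axioms. *)
Definition is_norm (R : realType) n (nrm : 'cV[R]_n -> R) : Prop :=
  [/\ forall u v, nrm (u + v) <= nrm u + nrm v,
      forall (s : R) u, nrm (s *: u) = `|s| * nrm u &
      forall u, nrm u = 0 -> u = 0].

Definition dual_norm (R : realType) n (nrm : 'cV[R]_n -> R) (b : 'cV[R]_n) : R :=
  sup [set dotp b u | u in [set u | nrm u <= 1]].

(** [R^n] with its Borel sigma-algebra; [probability (borelV R n) R] is the type
    of all Borel probability distributions on [R^n]. *)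
Notation borelV R n := (g_sigma_algebraType (@open 'cV[R]_n)).

(** The positivity proof [hN] is only needed for the total mass to be 1, i.e. to
    make [empirical hN xi] a [probability]. *)
Definition empirical (R : realType) n (N : nat) (hN : (0 < N)%N)
    (xi : 'I_N -> 'cV[R]_n) (A : set (borelV R n)) : \bar R :=
  ((N%:R^-1)%:E * \sum_(i < N) \d_(xi i : borelV R n) A)%E.

Section empirical_probability.
Context (R : realType) (n N : nat) (hN : (0 < N)%N) (xi : 'I_N -> 'cV[R]_n).
Local Open Scope ereal_scope.

Let empirical0 : empirical hN xi set0 = 0.
Proof. by rewrite /empirical big1 ?mule0// => i _; rewrite measure0. Qed.

Let empirical_ge0 A : 0 <= empirical hN xi A.
Proof.
rewrite /empirical mule_ge0 ?lee_fin ?invr_ge0 ?ler0n//.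
by apply: sume_ge0 => i _; exact: measure_ge0.
Qed.

Let empirical_sigma_additive : semi_sigma_additive (empirical hN xi).
Proof.
have rge0 : (0 <= N%:R^-1 :> R)%R by rewrite invr_ge0 ler0n.
pose m k : {measure set (borelV R n) -> \bar R} :=
  \d_(oapp xi (0%R : 'cV[R]_n) (insub k) : borelV R n).
have -> : empirical hN xi = mscale (NngNum rge0) (msum m N).
  apply/funext => A; rewrite /empirical /mscale/= /msum; congr (_ * _).
  by apply: eq_bigr => i _; rewrite /m valK.
exact: measure_semi_sigma_additive.
Qed.

HB.instance Definition _ := isMeasure.Build _ (borelV R n) R
  (empirical hN xi) empirical0 empirical_ge0 empirical_sigma_additive.

Let empirical_setT : empirical hN xi setT = 1.
Proof.
rewrite /empirical (eq_bigr (fun=> 1%:E)) => [|i _]; last by rewrite diracT.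
rewrite sumEFin sumr_const card_ord -EFinM.
by rewrite mulVf// pnatr_eq0 -lt0n.
Qed.

HB.instance Definition _ := Measure_isProbability.Build _ (borelV R n) R
  (empirical hN xi) empirical_setT.
End empirical_probability.

Definition coupling (R : realType) n (P Q : probability (borelV R n) R)
    (Pi : probability (borelV R n * borelV R n)%type R) : Prop :=
  (forall A : set (borelV R n), measurable A -> pushforward Pi fst A = P A) /\
  (forall A : set (borelV R n), measurable A -> pushforward Pi snd A = Q A).

(** Valued in [\bar R]: the transport cost can be [+oo] for distributions
    without first moment. *)
Definition wasserstein (R : realType) n (nrm : 'cV[R]_n -> R)
    (P Q : probability (borelV R n) R) : \bar R :=
  ereal_inf [set (\int[Pi]_z (nrm ((z.1 : 'cV[R]_n) - (z.2 : 'cV[R]_n)))%:E)%E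
            | Pi in coupling P Q].

Definition ambiguity (R : realType) n (nrm : 'cV[R]_n -> R) N (hN : (0 < N)%N)
    (xi : 'I_N -> 'cV[R]_n) (theta : R) : set (probability (borelV R n) R) :=
  [set Q | (wasserstein nrm (empirical hN xi) Q <= theta%:E)%E].

Definition safety_set (R : realType) K L P (a : 'I_P -> 'cV[R]_L)
    (b : 'I_P -> 'cV[R]_K) (d : 'I_P -> R) (x : 'cV[R]_L) : set 'cV[R]_K :=
  [set xi | forall p, dotp (b p) xi + d p - dotp (a p) x > 0].

Definition X_DR (R : realType) K L (nrm : 'cV[R]_K -> R) (X : set 'cV[R]_L)
    (S : 'cV[R]_L -> set 'cV[R]_K) N (hN : (0 < N)%N) (xi : 'I_N -> 'cV[R]_K)
    (eps theta : R) : set 'cV[R]_L :=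
  [set x | X x /\
    (ereal_sup [set Q (~` S x) | Q in ambiguity nrm hN xi theta] <= eps%:E)%E].

(** [nth_largest v k] is the [(k+1)]-th largest of the [v i], counted with
    multiplicity; the default value 0 of [nth] is only reached when [N <= k]. *)
Definition nth_largest (R : realType) N (v : 'I_N -> R) (k : nat) : R :=
  nth 0 (sort >=%R [seq v i | i <- enum 'I_N]) k.

Definition big_M (R : realType) K L N P (nrm : 'cV[R]_K -> R) (X : set 'cV[R]_L)
    (xi : 'I_N -> 'cV[R]_K) (a : 'I_P -> 'cV[R]_L) (b : 'I_P -> 'cV[R]_K)
    (d : 'I_P -> R) (M : R) : Prop :=
  0 < M /\ forall x i p, X x ->
    `|dotp (b p) (xi i) + d p - dotp (a p) x| / dual_norm nrm (b p) <= M.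

(** The binary vector [z] is a [bool]-valued family, coerced to 0/1. *)
Definition mip_feasible (R : realType) K L N P (nrm : 'cV[R]_K -> R)
    (X : set 'cV[R]_L) (xi : 'I_N -> 'cV[R]_K) (a : 'I_P -> 'cV[R]_L)
    (b : 'I_P -> 'cV[R]_K) (d : 'I_P -> R) (eps theta M : R) (k : nat)
    (q : 'I_P -> R) (z : 'I_N -> bool) (r : 'I_N -> R) (t : R) (x : 'cV[R]_L) :
    Prop :=
  [/\ 0 <= t, forall i, 0 <= r i & X x] /\
  [/\ eps * t >= theta + N%:R^-1 * \sum_(i < N) r i,
      forall i, M * (1 - (z i)%:R) >= t - r i,
      (\sum_(i < N) z i <= k)%N &
      forall i p,
        (dotp (b p) (xi i) + d p - dotp (a p) x) / dual_norm nrm (b p)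
        + (- dotp (b p) (xi i) - q p) / dual_norm nrm (b p) * (z i)%:R
        >= t - r i].

(* Main.v *)
(** Let [f] be the [nrm]-distance to the unsafe set [C], the complement of the
    safety set: [f u] is the positive part of the least of the slacks divided by
    dual norms.

    Robust chance constraint: [sup_Q Q C <= eps] holds iff
    [theta + 1/N * sum_i (t - f (xi i))^+ <= eps * t] for some [t >= 0]. If such a
    [t] exists, integrate [t * 1_C v <= (t - f u)^+ + nrm (u - v)] against a
    coupling. If not, take [t] an [eps]-quantile of the [f (xi i)]: moving to [C]
    the mass of the samples below [t], and a suitable fraction of the mass of
    those at [t], costs less than [theta] and makes the probability of [C] exceed
    [eps].

    Mixed-integer program: a solution [t] has at most [k] samples with
    [f (xi i) = 0]; these get [z i = 1], and their number bounds the [k+1]-st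
    largest value, so [q p <= d p - dotp (a p) x] and the corresponding
    constraints hold. Conversely the constraints force [r i >= (t - f (xi i))^+]. *)

Require Import Defs.
From HB Require Import structures.
From mathcomp Require Import all_boot all_order all_algebra.
From mathcomp Require Import all_classical all_reals all_analysis.
From mathcomp Require Import measurable_realfun.
From mathcomp Require Import lra.
Import Order.TTheory GRing.Theory Num.Theory.
Import numFieldNormedType.Exports.
Local Open Scope classical_set_scope.
Local Open Scope ring_scope.
Import HBNNSimple.

(** * Finitely supported probability measures and their integrals *)

Section atomic.
Context {d} {T : measurableType d} {R : realType} {I : finType}.
Variables (w : I -> R) (w_ge0 : forall i, 0 <= w i) (w_sum1 : \sum_i w i = 1).
Variable x : I -> T.
Local Open Scope ereal_scope.

(** The two proofs are carried as arguments so that the instances below can recover them from the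
    term. *)
Definition atomic of (forall i, 0 <= w i)%R & (\sum_i w i)%R = 1%R :=
  fun A : set T => \sum_i (w i)%:E * \d_(x i) A.

Local Notation mu := (atomic w_ge0 w_sum1).

Let m k : {measure set T -> \bar R} :=
  if insub k is Some j then
    mscale (NngNum (w_ge0 (enum_val (j : 'I_#|I|)))) \d_(x (enum_val j))
  else mzero.

Let atomicE : mu = msum m #|I|.
Proof.
apply/funext => A; rewrite /atomic /msum big_enum_val/=.
by apply: eq_bigr => i _; rewrite /m valK.
Qed.

Let atomic0 : mu set0 = 0.
Proof. by rewrite atomicE measure0. Qed.

Let atomic_ge0 A : 0 <= mu A.
Proof. by rewrite atomicE measure_ge0. Qed.

Let atomic_sigma_additive : semi_sigma_additive mu.
Proof. by rewrite atomicE; exact: measure_semi_sigma_additive. Qed.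

HB.instance Definition _ := isMeasure.Build _ T R mu
  atomic0 atomic_ge0 atomic_sigma_additive.

Let atomicT : mu setT = 1.
Proof.
rewrite /atomic (eq_bigr (fun i => (w i)%:E)) => [|i _]; last first.
  by rewrite diracT mule1.
by rewrite sumEFin w_sum1.
Qed.

HB.instance Definition _ := Measure_isProbability.Build _ T R mu atomicT.

Lemma integral_atomic (f : T -> \bar R) :
    (forall z, 0 <= f z) -> measurable_fun setT f ->
  \int[mu]_z f z = \sum_i (w i)%:E * f (x i).
Proof.
move=> f0 mf; rewrite (eq_measure_integral (msum m #|I|)); last first.
  by move=> A _ _; rewrite -[LHS]/(mu A) atomicE.
rewrite ge0_integral_measure_sum// [RHS]big_enum_val/=.
apply: eq_bigr => i _; rewrite /m valK ge0_integral_mscale//.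
by rewrite integral_dirac// diracT mul1e.
Qed.

(** Meant for the transport cost: the integral is a supremum over simple functions below [f], and
    each of those is integrated exactly. *)
Lemma integral_atomic_le (f : T -> \bar R) : (forall z, 0 <= f z) ->
  \int[mu]_z f z <= \sum_i (w i)%:E * f (x i).
Proof.
move=> f0; rewrite ge0_integralTE//; apply: ge_ereal_sup => _ [h hf <-].
rewrite -integralT_nnsfun integral_atomic//; last 2 first.
- by move=> z; rewrite lee_fin.
- exact/measurable_EFinP.
by apply: lee_sum => i _; rewrite lee_wpmul2l// lee_fin.
Qed.

End atomic.

(* [ge0_le_integral] without measurability: it spares proving that
   [nrm (z.1 - z.2)] is measurable for the product sigma-algebra. *)
Lemma le_integral_ge0_nonmeasurable {d} {T : measurableType d} {R : realType}
    (mu : {measure set T -> \bar R}) (f g : T -> \bar R) :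
  (forall z, 0 <= f z)%E -> (forall z, f z <= g z)%E ->
  (\int[mu]_z f z <= \int[mu]_z g z)%E.
Proof.
move=> f0 fg; rewrite !ge0_integralTE//; last first.
  by move=> z; exact: le_trans (f0 z) (fg z).
apply: ge_ereal_sup => _ [h hf <-]; apply: ereal_sup_ubound; exists h => //= z.
exact: le_trans (hf z) (fg z).
Qed.

Lemma empiricalE {R : realType} n N (hN : (0 < N)%N) (xi : 'I_N -> 'cV[R]_n)
    (A : set (borelV R n)) :
  (empirical hN xi A = \sum_(i < N) N%:R^-1%:E * \d_(xi i : borelV R n) A)%E.
Proof. by rewrite /empirical ge0_sume_distrr. Qed.

Lemma integral_empirical {R : realType} n N (hN : (0 < N)%N)
    (xi : 'I_N -> 'cV[R]_n) (f : borelV R n -> \bar R) :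
    (forall z, 0 <= f z)%E -> measurable_fun setT f ->
  (\int[empirical hN xi]_z f z = N%:R^-1%:E * \sum_(i < N) f (xi i))%E.
Proof.
move=> f0 mf.
have w0 (i : 'I_N) : 0 <= N%:R^-1 :> R by rewrite invr_ge0 ler0n.
have w1 : \sum_(i < N) N%:R^-1 = 1 :> R.
  by rewrite sumr_const card_ord -[_ *+ _]mulr_natr mulVf// pnatr_eq0 -lt0n.
rewrite (eq_measure_integral (atomic _ (xi : 'I_N -> borelV R n) w0 w1)).
  by rewrite integral_atomic// ge0_sume_distrr.
by move=> A _ _; rewrite -[LHS]/(empirical hN xi A) empiricalE.
Qed.

(** * Elementary consequences of the norm axioms *)

Section norm.
Context {R : realType} {n : nat} {nrm : 'cV[R]_n -> R} (nrmP : is_norm nrm).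

Lemma is_norm0 : nrm 0 = 0.
Proof. by case: nrmP => _ nZ _; rewrite -(scale0r 0) nZ normr0 mul0r. Qed.

Lemma is_normN u : nrm (- u) = nrm u.
Proof. by case: nrmP => _ nZ _; rewrite -scaleN1r nZ normrN1 mul1r. Qed.

Lemma is_norm_ge0 u : 0 <= nrm u.
Proof.
case: nrmP => nD _ _; have := nD u (- u).
by rewrite subrr is_norm0 is_normN -mulr2n pmulrn_lge0.
Qed.

End norm.

(** * Probability of an event over the Wasserstein ball *)

Section robust.
Context {R : realType} {n N : nat} (hN : (0 < N)%N).
Context {nrm : 'cV[R]_n -> R} (nrmP : is_norm nrm).
Context (xi : 'I_N -> 'cV[R]_n) (theta : R).
Context (C : set 'cV[R]_n) (mC : measurable (C : set (borelV R n))).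

(** Weak duality; [f] only has to be a lower bound for the distance to [C]. *)
Lemma ambiguity_prob_le (f : 'cV[R]_n -> R) (t : R) (Q : probability (borelV R n) R) :
    measurable_fun setT (f : borelV R n -> R) -> 0 <= t ->
    (forall u v, C v -> f u <= nrm (u - v)) ->
    ambiguity nrm hN xi theta Q ->
  (t%:E * Q C <=
   (theta + N%:R^-1 * \sum_(i < N) Num.max 0 (t - f (xi i)))%:E)%E.
Proof.
move=> mf t0 fC; rewrite /ambiguity/= => Wle.
pose g u := Num.max 0 (t - f u).
have g0 u : 0 <= g u by rewrite le_max lexx.
have mg : measurable_fun setT (EFin \o g : borelV R n -> \bar R).
  apply/measurable_EFinP; apply: measurable_maxr; first exact: measurable_cst.
  by apply: measurable_funB => //; exact: measurable_cst.
have QCfin : Q C \is a fin_num by rewrite fin_num_measure.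
have tQfin : (t%:E * Q C)%E \is a fin_num by rewrite fin_numM.
rewrite EFinD -leeBlDr//; apply: le_trans Wle.
(* Bounding the cost of each coupling separately avoids the existence of an optimal one. *)
apply: le_ereal_inf_tmp => _ [Pi [Pi1 Pi2] <-].
set s := N%:R^-1 * _.
have sE : (s%:E = \int[Pi]_z (g z.1)%:E)%E.
  transitivity (\int[pushforward Pi fst]_u (g u)%:E)%E; last first.
    rewrite ge0_integral_pushforward//.
    by move=> u _; rewrite lee_fin.
  rewrite (eq_measure_integral (empirical hN xi)); last first.
    by move=> A mA _; exact: Pi1.
  rewrite integral_empirical//.
  by rewrite sumEFin -EFinM.
(* [h] is a measurable minorant of the transport cost, and [h + g] dominates [t * \1_C]; additivity
   of the integral is applied to this pair. *)
pose h (z : borelV R n * borelV R n) := Num.max 0 (t * \1_C z.2 - g z.1).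
have mg1 : measurable_fun setT (fun z : borelV R n * borelV R n => g z.1).
  apply: (measurableT_comp (f := g : borelV R n -> R)); last exact: measurable_fst.
  exact/measurable_EFinP.
have mC2 : measurable_fun setT
    (fun z : borelV R n * borelV R n => t * \1_(C : set (borelV R n)) z.2).
  apply: measurable_funM; first exact: measurable_cst.
  apply: (measurableT_comp (f := \1_(C : set (borelV R n)) : _ -> R)).
    exact: measurable_indic.
  exact: measurable_snd.
have mh : measurable_fun setT h.
  apply: measurable_maxr; first exact: measurable_cst.
  exact: measurable_funB.
have QE : (t%:E * Q C = \int[Pi]_z (t * \1_C z.2)%:E)%E.
  have -> : Q C = (\int[Q]_v (\1_C v)%:E)%E by rewrite integral_indic// setIT.
  rewrite -ge0_integralZl//; last first.
    by apply/measurable_EFinP; exact: measurable_indic.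
  transitivity (\int[pushforward Pi snd]_v (t * \1_C v)%:E)%E; last first.
    rewrite ge0_integral_pushforward//.
    - apply/measurable_EFinP; apply: measurable_funM; first exact: measurable_cst.
      exact: measurable_indic.
    - by move=> v _; rewrite lee_fin mulr_ge0.
  by apply: eq_measure_integral => A mA _; exact/esym/Pi2.
rewrite leeBlDr// sE QE.
apply: (@le_trans _ _ (\int[Pi]_z ((h z)%:E + (g z.1)%:E))%E).
  apply: le_integral_ge0_nonmeasurable => z.
    by rewrite lee_fin mulr_ge0.
  by rewrite -EFinD lee_fin -lerBlDr le_max lexx orbT.
rewrite ge0_integralD//; last 4 first.
- by move=> z _; rewrite lee_fin le_max lexx.
- exact/measurable_EFinP.
- by move=> z _; rewrite lee_fin.
- exact/measurable_EFinP.
rewrite leeD2r//; apply: le_integral_ge0_nonmeasurable => z.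
  by rewrite lee_fin le_max lexx.
rewrite lee_fin ge_max is_norm_ge0//= lerBlDr indicE.
have [/set_mem Cz2|_] := boolP (z.2 \in C); last first.
  by rewrite mulr0 addr_ge0// is_norm_ge0.
rewrite mulr1 -lerBlDr; apply: (@le_trans _ _ (f z.1)); last exact: fC.
by rewrite lerBlDr -lerBlDl le_max lexx orbT.
Qed.

(** Send the fraction [w i] of the mass at sample [i] to [y i]. Mass that stays may lie in [C] as
    well, hence an inequality for [Q C]. *)
Lemma ambiguity_move (w : 'I_N -> R) (y : 'I_N -> 'cV[R]_n) :
    (forall i, 0 <= w i <= 1) -> (forall i, C (y i)) ->
    N%:R^-1 * \sum_(i < N) w i * nrm (xi i - y i) <= theta ->
  exists2 Q : probability (borelV R n) R, ambiguity nrm hN xi theta Q &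
    ((N%:R^-1 * \sum_(i < N) w i)%:E <= Q C)%E.
Proof.
move=> w01 Cy cost.
(* Atom [(i, true)] is the moved share of sample [i] and [(i, false)] the share that stays; [p]
   pairs origin with destination. *)
pose a (ib : 'I_N * bool) := N%:R^-1 * (if ib.2 then w ib.1 else 1 - w ib.1).
pose p (ib : 'I_N * bool) := (xi ib.1, if ib.2 then y ib.1 else xi ib.1).
have a0 ib : 0 <= a ib.
  rewrite mulr_ge0 ?invr_ge0 ?ler0n//; have /andP[wge0 wle1] := w01 ib.1.
  by case: ifP => // _; rewrite subr_ge0.
have sumib (F : 'I_N * bool -> \bar R) :
    (\sum_ib F ib = \sum_(i < N) (F (i, true) + F (i, false)))%E.
  rewrite (eq_bigr (fun ib => F (ib.1, ib.2))); last by case.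
  rewrite -(pair_bigA _ (fun i b => F (i, b)))/=.
  by apply: eq_bigr => i _; rewrite big_bool.
have a1 : \sum_ib a ib = 1.
  apply: EFin_inj; rewrite -sumEFin sumib.
  rewrite (eq_bigr (fun=> N%:R^-1%:E)); last first.
    by move=> i _; rewrite -EFinD /a/= -mulrDr addrC subrK mulr1.
  by rewrite sumEFin sumr_const card_ord -[_ *+ _]mulr_natr mulVf// pnatr_eq0 -lt0n.
pose Pi : probability (borelV R n * borelV R n)%type R :=
  atomic _ (p : _ -> borelV R n * borelV R n)%type a0 a1.
pose Q : probability (borelV R n) R :=
  atomic _ (fun ib => (p ib).2 : borelV R n) a0 a1.
exists Q; last first.
  rewrite /Q/= /atomic sumib mulr_sumr -sumEFin; apply: lee_sum => i _.
  rewrite !diracE/= mem_set// mule1 leeDl// mule_ge0//.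
  by rewrite lee_fin.
apply: (@le_trans _ _ (\int[Pi]_z (nrm ((z.1 : 'cV[R]_n) - (z.2 : 'cV[R]_n)))%:E)%E).
  apply: ereal_inf_lbound; exists Pi => //; split => A mA; last by [].
  rewrite /pushforward /Pi/= /atomic -[RHS]/(empirical hN xi A) empiricalE sumib.
  apply: eq_bigr => i _; rewrite /a/= !diracE -ge0_muleDl//.
  - by rewrite -EFinD -mulrDr addrC subrK mulr1.
  - exact: (a0 (i, true)).
  - exact: (a0 (i, false)).
apply: (@le_trans _ _ (\sum_ib (a ib)%:E * (nrm ((p ib).1 - (p ib).2))%:E)%E).
  by apply: integral_atomic_le => z; rewrite lee_fin is_norm_ge0.
rewrite sumib (eq_bigr (fun i => (N%:R^-1 * (w i * nrm (xi i - y i)))%:E)).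
  by rewrite sumEFin lee_fin -mulr_sumr.
by move=> i _; rewrite /p/a/= subrr (is_norm0 nrmP) mule0 adde0 -EFinM mulrA.
Qed.

End robust.

(** * Quantiles and the fractional knapsack *)

Section fractional_weights.
Context {R : realType} {I : finType} (f : I -> R).

(** Take the least value [f j] whose lower level set has more than [e] points. If more than [e]
    points lay strictly below it, the largest value among them would qualify too. *)
Lemma exists_quantile (e : R) : 0 <= e < #|I|%:R ->
  exists2 j, \sum_i (f i < f j)%R%:R <= e & e < \sum_i (f i <= f j)%R%:R.
Proof.
move=> /andP[e0 eI].
have I_gt0 : (0 < #|I|)%N by rewrite -(ltr0n R); exact: le_lt_trans eI.
have [i0 _] : exists i0 : I, i0 \in predT by apply/card_gt0P.
pose P j := e < \sum_i (f i <= f j)%R%:R.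
have [m _ mP] := arg_maxP f (isT : predT i0).
have Pm : P m.
  rewrite /P (eq_bigr (fun=> 1)) => [|i _]; last by have -> : f i <= f m by exact: mP.
  by rewrite sumr_const.
have [j Pj jP] := @arg_minP _ _ _ m P f Pm.
exists j => //; rewrite leNgt; apply/negP => eA.
have [i1 fi1] : exists i, f i < f j.
  apply/existsP; apply: contraTT eA => /existsPn H.
  by rewrite -leNgt big1// => i _; rewrite (negbTE (H i)).
have [i fi iP] := @arg_maxP _ _ _ i1 (fun i => f i < f j) f fi1.
have : f j <= f i.
  apply: jP; rewrite /P; apply: lt_le_trans eA _.
  apply: ler_sum => l _; case: (ltP (f l) (f j)) => // fl.
  by have -> : f l <= f i by exact: iP.
by rewrite leNgt fi.
Qed.

(* The weights are an optimal solution of the fractional knapsack problem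
   (greedily moving the cheapest points), perturbed slightly upwards; the
   hypothesis at the quantile [t] says that the knapsack value is below [B]. *)
Lemma exists_fractional_weights (e B : R) : 0 <= e < #|I|%:R ->
    (forall i, 0 <= f i) ->
    (forall t, 0 <= t -> e * t - \sum_i Num.max 0 (t - f i) < B) ->
  exists w : I -> R, [/\ forall i, 0 <= w i <= 1,
    e < \sum_i w i & \sum_i w i * f i < B].
Proof.
move=> eI f0 eB; have [j] := exists_quantile _ eI; set t := f j => Ae eAE.
have {eB} := eB t (f0 j).
(* [A] and [E] count the points strictly below and exactly at the quantile; [S] is the cost of
   moving the former entirely. *)
set A := \sum_i _ in Ae; pose S := \sum_i (f i < t)%R%:R * f i.
pose E : R := \sum_i (f i == t)%:R.
have {}eAE : e < A + E.
  apply: lt_le_trans eAE _; rewrite -big_split/=; apply: ler_sum => i _.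
  by case: ltgtP; rewrite ?addr0 ?add0r.
have -> : \sum_i Num.max 0 (t - f i) = A * t - S.
  rewrite mulr_suml -sumrB; apply: eq_bigr => i _.
  case: ltP => fi; first by rewrite !mul1r max_r// subr_ge0 ltW.
  by rewrite !mul0r subr0 max_l// subr_le0.
move=> GB; have E0 : 0 < E by lra.
have t0 : 0 <= t := f0 j.
pose G := e * t - (A * t - S).
(* The first bound keeps the weight at the quantile at most 1, the second keeps the cost below [B];
   [t + 1] guards against [t = 0]. *)
pose dl := Num.min (E - (e - A)) ((B - G) / (t + 1)).
have dl0 : 0 < dl.
  by rewrite lt_min divr_gt0 ?andbT; rewrite /G; lra.
have dlE : dl <= E - (e - A) by rewrite ge_min lexx.
have dlB : dl * t < B - G.
  have : dl * (t + 1) <= B - G.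
    by rewrite -ler_pdivlMr ?ge_min ?lexx ?orbT//; lra.
  by rewrite mulrDr mulr1; lra.
(* Common weight of the points at the quantile, chosen so that the total weight is [e + dl]. *)
pose c := (e - A + dl) / E.
have c0 : 0 <= c by rewrite divr_ge0//; lra.
have c1 : c <= 1 by rewrite ler_pdivrMr// mul1r; lra.
have cE : c * E = e - A + dl by rewrite divfK// gt_eqF.
exists (fun i => (f i < t)%R%:R + c * (f i == t)%:R); split.
- move=> i; case: ltgtP => _; rewrite ?mulr0 ?mulr1 ?addr0 ?add0r ?ler01 ?lexx//.
  by rewrite c0 c1.
- by rewrite big_split/= -mulr_sumr -/A -/E cE; lra.
- rewrite (eq_bigr (fun i => (f i < t)%R%:R * f i + c * (f i == t)%:R * t)).
    rewrite big_split/= -mulr_suml -mulr_sumr -/E -/S cE.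
    rewrite /G in dlB; lra.
  by move=> i _; rewrite mulrDl; case: eqP => [->//|_]; rewrite !mulr0 !mul0r.
Qed.

End fractional_weights.

(** * Strong duality for the robust chance constraint *)

(** The last two hypotheses say that [f] is the distance to [C], without asking for a nearest
    point. *)
Lemma robust_chance_constraintP {R : realType} {n N : nat} (hN : (0 < N)%N)
    {nrm : 'cV[R]_n -> R} (nrmP : is_norm nrm) (xi : 'I_N -> 'cV[R]_n)
    (eps theta : R) (C : set 'cV[R]_n) (f : 'cV[R]_n -> R) :
    0 < eps < 1 -> 0 < theta ->
    measurable (C : set (borelV R n)) ->
    measurable_fun setT (f : borelV R n -> R) ->
    (forall u, 0 <= f u) ->
    (forall u v, C v -> f u <= nrm (u - v)) ->
    (forall u (e : R), 0 < e -> exists2 v, C v & nrm (u - v) <= f u + e) ->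
  (ereal_sup [set Q C | Q in ambiguity nrm hN xi theta] <= eps%:E)%E <->
  exists2 t : R, 0 <= t &
    theta + N%:R^-1 * \sum_(i < N) Num.max 0 (t - f (xi i)) <= eps * t.
Proof.
move=> /andP[eps0 eps1] theta0 mC mf f0 fle fge.
have N0 : 0 < N%:R :> R by rewrite ltr0n.
split=> [supQ|[t t0 tP]]; last first.
  have sum0 : 0 <= N%:R^-1 * \sum_(i < N) Num.max 0 (t - f (xi i)).
    apply: mulr_ge0; first by rewrite invr_ge0 ltW.
    by apply: sumr_ge0 => i _; rewrite le_max lexx.
  (* [eps * t >= theta > 0] forces [t > 0], so the weak duality bound can be divided by [t]. *)
  have {t0} t0 : 0 < t by rewrite -(pmulr_rgt0 _ eps0); lra.
  apply: ge_ereal_sup => _ [Q ambQ <-].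
  have := ambiguity_prob_le hN nrmP _ _ _ mC _ _ _ mf (ltW t0) fle ambQ.
  move=> /le_trans /(_ (_ : _ <= (t * eps)%:E)%E).
  rewrite lee_fin [t * _]mulrC => /(_ tP).
  by rewrite [eps * _]mulrC EFinM lee_pmul2l.
apply: contrapT => noT.
have [|||w [w01 wgt wlt]] :=
    @exists_fractional_weights R 'I_N (f \o xi) (eps * N%:R) (N%:R * theta).
- by rewrite card_ord mulr_ge0 ?ltW//= gtr_pMl.
- by move=> i; exact: f0.
- move=> t t0; rewrite ltNge; apply/negP => tP; apply: noT; exists t => //.
  rewrite -lerBrDr -(ler_pM2l N0); apply: le_trans tP _.
  by rewrite mulrBr mulVKf ?gt_eqF// mulrCA mulrA.
(* The unspent budget per sample pays for destinations that are only nearly closest. *)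
pose dl := (N%:R * theta - \sum_i w i * f (xi i)) / N%:R.
have dl0 : 0 < dl by rewrite divr_gt0// subr_gt0.
have [y yP] : {y : 'I_N -> 'cV[R]_n &
    forall i, C (y i) /\ nrm (xi i - y i) <= f (xi i) + dl}.
  apply: (@choice _ _ (fun i v => C v /\ nrm (xi i - v) <= f (xi i) + dl)) => i.
  by have [v ? ?] := fge (xi i) _ dl0; exists v.
have [i||Q ambQ QC] := ambiguity_move hN nrmP xi theta C w y w01.
- by case: (yP i).
- rewrite mulrC ler_pdivrMr// [theta * _]mulrC.
  apply: (@le_trans _ _ (\sum_i (w i * f (xi i) + dl))).
    apply: ler_sum => i _; have [_ yi] := yP i; have /andP[wi0 wi1] := w01 i.
    apply: le_trans (ler_wpM2l wi0 yi) _; rewrite mulrDr lerD2l.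
    by rewrite ger_pMl.
  rewrite big_split/= sumr_const card_ord -[dl *+ _]mulr_natr divfK ?gt_eqF//.
  by rewrite addrC subrK.
have : (eps%:E < Q C)%E.
  by apply: lt_le_trans QC; rewrite lte_fin mulrC ltr_pdivlMr.
rewrite ltNge => /negP; apply; apply: le_trans supQ.
by apply: ereal_sup_ubound; exists Q.
Qed.

(** * The scalar product and its measurability *)

Section dotp.
Context {R : realType} {n : nat} (b : 'cV[R]_n).

Lemma dotpD u v : dotp b (u + v) = dotp b u + dotp b v.
Proof. by rewrite /dotp mulmxDr mxE. Qed.

Lemma dotpZ s u : dotp b (s *: u) = s * dotp b u.
Proof. by rewrite /dotp -scalemxAr mxE. Qed.

Lemma dotpN u : dotp b (- u) = - dotp b u.
Proof. by rewrite /dotp mulmxN mxE. Qed.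

Lemma dotpE u : dotp b u = \sum_i b i 0 * u i 0.
Proof. by rewrite /dotp mxE; apply: eq_bigr => i _; rewrite mxE. Qed.

Lemma measurable_dotp : measurable_fun setT (dotp b : borelV R n -> R).
Proof.
rewrite (_ : dotp b = fun u => \sum_i b i 0 * u i 0); last exact/funext/dotpE.
apply: measurable_sum => i; apply: measurable_funM; first exact: measurable_cst.
move=> mT; apply: (measurability _ (RGenOpens.measurableE R)) => //
 _ [_ [x [y ->] <-]]; rewrite setTI; apply: sub_sigma_algebra.
have /continuousP := @coord_continuous R n 1 i 0; apply.
exact: interval_open.
Qed.

End dotp.

(** * Comparison of an arbitrary norm with the max norm *)

Section norm_equivalence.
Context {R : realType} {n : nat}.

Lemma ler_coord_norm m (v : 'M[R]_(m, n)) i j : `|v i j| <= `|v|.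
Proof.
rewrite [leRHS]/Num.norm/= mx_normrE.
exact: (le_bigmax _ (fun ij : 'I_m * 'I_n => `|v ij.1 ij.2|) (i, j)).
Qed.

Lemma dotp_tr_le (b : 'cV[R]_n) (v : 'rV[R]_n) :
  dotp b v^T <= (\sum_i `|b i 0|) * `|v|.
Proof.
rewrite dotpE mulr_suml; apply: ler_sum => i _; rewrite mxE.
apply: le_trans (ler_norm _) _; rewrite normrM.
by rewrite ler_wpM2l// ler_coord_norm.
Qed.

Context {nrm : 'cV[R]_n -> R} (nrmP : is_norm nrm).

Lemma is_norm_tr_le (v : 'rV[R]_n) :
  nrm v^T <= (\sum_i nrm (delta_mx i 0)) * `|v|.
Proof.
have [nD nZ _] := nrmP.
rewrite [in leLHS](matrix_sum_delta v^T) exchange_big big_ord1 mulr_suml.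
elim/big_ind2 : _ => [|x x' y y' xx' yy'|i _]; first by rewrite (is_norm0 nrmP).
  by apply: le_trans (nD _ _) _; exact: lerD.
by rewrite nZ mxE mulrC ler_wpM2l ?is_norm_ge0// ler_coord_norm.
Qed.

Lemma is_norm_tr_continuous : continuous (fun v : 'rV[R]_n => nrm v^T).
Proof.
have [nD nZ _] := nrmP.
(* A Lipschitz constant; [+ 1] makes it positive even for [n = 0]. *)
pose c := \sum_i nrm (delta_mx i 0) + 1.
have c0 : 0 < c by rewrite ltr_wpDl// sumr_ge0// => i _; exact: is_norm_ge0.
have lip u v : nrm u^T - nrm v^T <= c * `|u - v|.
  rewrite lerBlDr -[in leLHS](subrK v u) linearD/=.
  apply: le_trans (nD _ _) _; rewrite lerD2r.
  by apply: le_trans (is_norm_tr_le _) _; rewrite ler_wpM2r// lerDl.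
move=> v; apply/(@cvgrPdist_lt _ _ _ (nbhs v)) => e e0.
apply/nbhs_ballP; exists (e / c); first exact: divr_gt0.
move=> u /=; rewrite mx_norm_ball /ball_/= ltr_pdivlMr// mulrC => uv.
rewrite real_ltr_norml ?num_real//; apply/andP; split.
  rewrite ltrNl opprB; apply: le_lt_trans uv.
  by rewrite distrC; exact: lip.
exact: le_lt_trans (lip _ _) uv.
Qed.

(* By compactness of the unit sphere; stated for row vectors because the
   Heine-Borel theorem of the library is. *)
Lemma is_norm_tr_ge : exists2 c : R, 0 < c & forall v : 'rV[R]_n, c * `|v| <= nrm v^T.
Proof.
have [nD nZ n0] := nrmP.
pose S := [set v : 'rV[R]_n | `|v| = 1].
have Sv (v : 'rV[R]_n) : v != 0 -> S (`|v|^-1 *: v).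
  move=> v0; rewrite /S/= normrZ normfV normr_id mulVf//.
  by rewrite normr_eq0.
(* An empty sphere leaves only the zero vector, and any constant works. *)
have [[v0 Sv0]|S0] := pselect (S !=set0); last first.
  exists 1 => // v; have [->|/Sv vS] := eqVneq v 0.
    by rewrite normr0 mulr0 is_norm_ge0.
  by exfalso; apply: S0; eexists; exact: vS.
have cS : compact S.
  apply: bounded_closed_compact.
    by exists 1; split => // x x1 v; rewrite /S/= => ->; exact: ltW.
  apply: (@closed_comp _ _ (fun v : 'rV[R]_n => `|v|) [set 1]); last exact: closed_eq.
  by move=> v _; exact: norm_continuous.
have [||v Sv1 vmin] := @EVT_min_rV R n (fun v => nrm v^T) S _ cS.
- by exists v0.
- by apply: continuous_subspaceT; exact: is_norm_tr_continuous.
exists (nrm v^T) => [|u].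
  rewrite lt_neqAle is_norm_ge0// andbT eq_sym; apply/eqP => /n0 vT0.
  move: Sv1; rewrite inE /S/= -[v]trmxK vT0 linear0 normr0 => /esym/eqP.
  by rewrite oner_eq0.
have [->|u0] := eqVneq u 0; first by rewrite normr0 mulr0 is_norm_ge0.
have /vmin : `|u|^-1 *: u \in S by rewrite inE; exact: Sv.
rewrite linearZ/= nZ normfV normr_id mulrC.
by rewrite ler_pdivlMr// normr_gt0.
Qed.

End norm_equivalence.

(** * The dual norm *)

Section dual_norm.
Context {R : realType} {n : nat} {nrm : 'cV[R]_n -> R} (nrmP : is_norm nrm).
Variable b : 'cV[R]_n.

Let dual_set := [set dotp b u | u in [set u | nrm u <= 1]].

Let dual_set0 : dual_set !=set0.
Proof. by exists (dotp b 0), 0; rewrite //= (is_norm0 nrmP). Qed.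

(** Rules out the default value 0 that [sup] takes on unbounded sets; the bound comes from norm
    equivalence. *)
Let dual_set_ub : has_ubound dual_set.
Proof.
have [c c0 cP] := is_norm_tr_ge nrmP.
exists ((\sum_i `|b i 0|) / c) => _ [u /= u1 <-].
rewrite -[u]trmxK; apply: le_trans (dotp_tr_le _ _) _.
rewrite ler_wpM2l ?sumr_ge0//.
by rewrite -[leRHS]mul1r ler_pdivlMr// mulrC (le_trans (cP _))// trmxK.
Qed.

Lemma dotp_le_dual_norm u : dotp b u <= dual_norm nrm b * nrm u.
Proof.
have [nD nZ n0] := nrmP.
have [->|u0] := eqVneq u 0.
  by rewrite -(scale0r 0) dotpZ mul0r scale0r (is_norm0 nrmP) mulr0.
have nu0 : 0 < nrm u.
  rewrite lt_neqAle is_norm_ge0// andbT eq_sym.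
  by apply: contra_neq u0 => /n0.
rewrite -ler_pdivrMr// mulrC -dotpZ; apply: ub_le_sup => //.
by exists ((nrm u)^-1 *: u) => //=; rewrite nZ gtr0_norm ?invr_gt0// mulVf// gt_eqF.
Qed.

(** Test [dotp_le_dual_norm] at [u = b], where the left side is a nonzero sum of squares. *)
Lemma dual_norm_gt0 : b <> 0 -> 0 < dual_norm nrm b.
Proof.
move=> b0; have bb : 0 < dotp b b.
  rewrite dotpE lt_neqAle sumr_ge0 => [|i _]; last by rewrite -expr2 sqr_ge0.
  rewrite andbT eq_sym; apply/eqP => bb0; apply: b0.
  apply/matrixP => i j; rewrite ord1 mxE.
  move/eqP: bb0; rewrite psumr_eq0 => [|k _]; last by rewrite -expr2 sqr_ge0.
  by move=> /allP /(_ i); rewrite mem_index_enum mulf_eq0 orbb => /(_ isT)/eqP.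
have := lt_le_trans bb (dotp_le_dual_norm b).
have := is_norm_ge0 nrmP b.
rewrite le_eqVlt => /predU1P[<-|nb]; first by rewrite mulr0 ltxx.
by rewrite pmulr_lgt0.
Qed.

Lemma dual_norm_gt x : x < dual_norm nrm b ->
  exists2 u, nrm u <= 1 & x < dotp b u.
Proof. by move=> /(sup_gt dual_set0)[_ [u u1 <-] xu]; exists u. Qed.

End dual_norm.

(** * Distance to a union of half-spaces *)

Section distance.
Context {R : realType} {n P : nat} {nrm : 'cV[R]_n -> R} (nrmP : is_norm nrm).
Context (b : 'I_P -> 'cV[R]_n) (b_neq0 : forall p, b p <> 0) (e : 'I_P -> R).
Variable p0 : 'I_P.

Let g p u := (dotp (b p) u + e p) / dual_norm nrm (b p).

(** The distance to one half-space is the positive part of [g p], and that to the union is the least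
    of these. Seeding the minimum with [g p0 u] does not change it, [p0] being one of the
    indices. *)
Definition unsafe_dist u := Num.max 0 (\big[Num.min/g p0 u]_p g p u).

Let C := ~` [set u | forall p, 0 < dotp (b p) u + e p].

Lemma unsafe_dist_le u p : unsafe_dist u <= Num.max 0 (g p u).
Proof. by rewrite ge_max !le_max lexx/= bigmin_le orbT. Qed.

Lemma unsafe_distE u : exists p, unsafe_dist u = Num.max 0 (g p u).
Proof.
suff [p pE] : exists p, \big[Num.min/g p0 u]_p g p u = g p u.
  by exists p; rewrite /unsafe_dist pE.
elim/big_ind : _ => [|x y [p ->] [q ->]|p _]; [by exists p0| |by exists p].
by case: leP => _; [exists p|exists q].
Qed.

Lemma measurable_slack p :
  measurable_fun setT (fun u : borelV R n => dotp (b p) u + e p).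
Proof. by apply: measurable_funD => //; exact: measurable_dotp. Qed.

Lemma measurable_unsafe_dist :
  measurable_fun setT (unsafe_dist : borelV R n -> R).
Proof.
have mg p : measurable_fun setT (g p : borelV R n -> R).
  by apply: measurable_funM => //; exact: measurable_slack.
apply: measurable_maxr => //; elim: index_enum => [|p s IH].
  by apply: eq_measurable_fun (mg p0) => u _; rewrite big_nil.
apply: eq_measurable_fun (measurable_minr (mg p) IH) => u _.
by rewrite big_cons.
Qed.

Lemma measurable_unsafe : measurable (C : set (borelV R n)).
Proof.
apply: measurableC.
rewrite (_ : mkset _ = \bigcap_(p in setT)
    ((fun u : borelV R n => dotp (b p) u + e p) @^-1` `]0, +oo[)); last first.
  apply/seteqP; split => u /= uP p; first by move=> _; rewrite /preimage/= in_itv/= andbT.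
  by have := uP p I; rewrite /= in_itv/= andbT.
apply: fin_bigcap_measurable => // p _; rewrite -[X in measurable X]setTI.
by apply: measurable_slack.
Qed.

(** Some slack [p] is nonpositive at [v], so the slack at [u] is at most [dotp (b p) (u - v)]. *)
Lemma unsafe_dist_le_norm u v : C v -> unsafe_dist u <= nrm (u - v).
Proof.
move=> /existsNP[p /negP]; rewrite -leNgt => vp.
apply: le_trans (unsafe_dist_le u p) _; rewrite ge_max is_norm_ge0//=.
rewrite /g ler_pdivrMr ?dual_norm_gt0// mulrC.
apply: le_trans (dotp_le_dual_norm nrmP _ _); rewrite dotpD dotpN; lra.
Qed.

Lemma unsafe_near u (eta : R) : 0 < eta ->
  exists2 v, C v & nrm (u - v) <= unsafe_dist u + eta.
Proof.
move=> eta0; have [p ->] := unsafe_distE u.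
have [nD nZ _] := nrmP.
have B0 := dual_norm_gt0 nrmP _ (b_neq0 p).
have [s0|s0] := leP (dotp (b p) u + e p) 0.
  exists u; first by apply/existsNP; exists p; apply/negP; rewrite -leNgt.
  by rewrite subrr (is_norm0 nrmP) addr_ge0 ?le_max ?lexx// ltW.
set s := dotp (b p) u + e p in s0.
have gp0 : 0 < g p u by rewrite divr_gt0.
have gpB : g p u * dual_norm nrm (b p) = s by rewrite divfK// gt_eqF.
(* This ratio lies strictly below the dual norm, which yields a nearly optimal direction [w]. *)
have : s / (g p u + eta) < dual_norm nrm (b p).
  by rewrite ltr_pdivrMr ?addr_gt0// mulrDr mulrC gpB ltrDl mulr_gt0.
move=> /(dual_norm_gt nrmP)[w w1 sw].
have w0 : 0 < dotp (b p) w by apply: lt_trans sw; rewrite divr_gt0// addr_gt0.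
(* The step along [w] that brings slack [p] exactly to zero. *)
exists (u - (s / dotp (b p) w) *: w).
  apply/existsNP; exists p; apply/negP; rewrite -leNgt dotpD dotpN dotpZ.
  by rewrite divfK ?gt_eqF// -/s addrAC -/s subrr.
rewrite opprB addrC subrK nZ gtr0_norm ?divr_gt0// max_r; last exact: ltW.
apply: (@le_trans _ _ (s / dotp (b p) w)).
  by rewrite ger_pMr// divr_gt0.
rewrite ler_pdivrMr//; move: sw; rewrite ltr_pdivrMr ?addr_gt0// => /ltW.
by rewrite mulrC.
Qed.

End distance.

(** * Order statistics and the mixed-integer program *)

(** If the entry at index [k] exceeds [y], so do all [k + 1] entries up to it in the decreasing
    list. [k < N] keeps [nth] off its default. *)
Lemma nth_largest_le {R : realType} (N : nat) (v : 'I_N -> R) (k : nat) (y : R) :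
    (k < N)%N -> (\sum_(i < N) (y < v i)%R <= k)%N ->
  nth_largest v k <= y.
Proof.
move=> kN; apply: contraTT; rewrite -ltNge -ltnNge /nth_largest.
set s := sort _ _ => yk.
have size_s : size s = N by rewrite size_sort size_map size_enum_ord.
have ss : sorted >=%R s by apply: sort_sorted => u w; exact: le_total.
have -> : (\sum_(i < N) (y < v i)%R)%N = count (> y) s.
  rewrite /s (seq.permP (permEl (perm_sort _ _))) count_map -sum1_count big_enum_cond/=.
  by rewrite [RHS]big_mkcond/=; apply: eq_bigr => i _; case: ltP.
rewrite -(cat_take_drop k.+1 s) count_cat.
apply: (@leq_trans (count (> y) (take k.+1 s))); last exact: leq_addr.
suff : all (> y) (take k.+1 s).
  by rewrite all_count => /eqP->; rewrite size_takel ?size_s.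
apply/(all_nthP 0) => j; rewrite size_takel ?size_s// ltnS => jk.
rewrite nth_take//=; apply: (lt_le_trans yk).
apply: (sorted_leq_nth (leT := >=%R)) => //.
- by move=> u w z wu zu; exact: le_trans zu wu.
- by move=> u; exact: lexx.
- by rewrite inE size_s (leq_ltn_trans jk).
- by rewrite inE size_s.
Qed.

Theorem theorem2 (R : realType) (K L N P : nat)
    (hK : (0 < K)%N) (hL : (0 < L)%N) (hN : (0 < N)%N) (hP : (0 < P)%N)
    (X : set 'cV[R]_L) (hX : compact X)
    (nrm : 'cV[R]_K -> R) (hnrm : is_norm nrm)
    (xi : 'I_N -> 'cV[R]_K)
    (eps : R) (heps0 : 0 < eps) (heps1 : eps < 1)
    (theta : R) (htheta : 0 < theta)
    (a : 'I_P -> 'cV[R]_L) (b : 'I_P -> 'cV[R]_K) (hb : forall p, b p <> 0)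
    (d : 'I_P -> R)
    (k : nat) (hk : k%:Z = Num.floor (eps * N%:R))
    (q : 'I_P -> R)
    (hq : forall p, q p = nth_largest (fun i => - dotp (b p) (xi i)) k)
    (M : R) (hM : big_M nrm X xi a b d M) :
  X_DR nrm X (safety_set a b d) hN xi eps theta =
  [set x | X x /\ exists (z : 'I_N -> bool) (r : 'I_N -> R) (t : R),
     mip_feasible nrm X xi a b d eps theta M k q z r t x].
Proof.
have N0 : 0 < N%:R :> R by rewrite ltr0n.
have kle (m : nat) : (m <= k)%N = (m%:R <= eps * N%:R).
  by rewrite -lez_nat hk floor_ge_int.
have kN : (k < N)%N.
  rewrite -(ltr_nat R); have := leqnn k; rewrite kle => /le_lt_trans; apply.
  by rewrite gtr_pMl.
have B0 p := dual_norm_gt0 hnrm _ (hb p).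
pose p0 : 'I_P := Ordinal hP.
have [M0 hM1] := hM.
suff key x : X x ->
    (ereal_sup [set Q (~` safety_set a b d x) | Q in ambiguity nrm hN xi theta]
       <= eps%:E)%E <->
    exists (z : 'I_N -> bool) (r : 'I_N -> R) (t : R),
      mip_feasible nrm X xi a b d eps theta M k q z r t x.
  by apply/seteqP; split => x [Xx /(key _ Xx)].
move=> Xx; pose e p := d p - dotp (a p) x.
have -> : safety_set a b d x = [set u | forall p, 0 < dotp (b p) u + e p].
  by apply/seteqP; split => u uP p; have := uP p; rewrite /e addrA.
pose f := unsafe_dist (nrm := nrm) b e p0.
have f0 u : 0 <= f u by rewrite le_max lexx.
rewrite (@robust_chance_constraintP _ _ _ hN _ hnrm xi _ _ _ f); last first.
- by move=> u eta; exact: unsafe_near.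
- by move=> u v; exact: unsafe_dist_le_norm.
- exact: f0.
- exact: measurable_unsafe_dist.
- exact: measurable_unsafe.
- exact: htheta.
- by rewrite heps0.
split=> [[t t0 tP]|[z [r [t [[t0 r0 _] [tP hMr _ hr]]]]]]; last first.
  exists t => //; apply: le_trans tP; rewrite lerD2l ler_wpM2l ?invr_ge0 ?ler0n//.
  apply: ler_sum => i _; rewrite ge_max r0/= lerBlDr -lerBlDl.
  (* With [z i = 1] the big-M constraint gives [t - r i <= 0]; with [z i = 0] the constraint for the
     [p] attaining the distance applies. *)
  have := hMr i; case: (z i) (hr i) => [_|hri _].
    by rewrite subrr mulr0 => /le_trans; apply.
  have [p] := unsafe_distE (nrm := nrm) b e p0 (xi i); rewrite -/f => ->.
  by rewrite le_max /e addrA; have := hri p; rewrite mulr0 addr0 => ->; rewrite orbT.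
(* Flag exactly the samples that are at distance zero, and take the least admissible [r]. *)
pose z i := f (xi i) <= 0.
pose r i := Num.max 0 (t - f (xi i)).
have tr i : t - r i <= f (xi i) by rewrite lerBlDr -lerBlDl le_max lexx orbT.
have tpos : 0 < t.
  rewrite -(pmulr_rgt0 _ heps0); apply: lt_le_trans htheta (le_trans _ tP).
  rewrite lerDl mulr_ge0 ?invr_ge0 ?ler0n// sumr_ge0// => i _.
  by rewrite le_max lexx.
(* Each flagged sample has [r i >= t], while the sum of the [r i] is at most [eps * N * t]. *)
have zk : (\sum_(i < N) z i <= k)%N.
  rewrite kle natr_sum -(ler_pM2r tpos) mulr_suml.
  apply: (@le_trans _ _ (\sum_i r i)).
    apply: ler_sum => i _; rewrite /z /r le_max; case: (leP (f (xi i)) 0) => fi /=.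
      by rewrite mul1r lerDl oppr_ge0 fi orbT.
    by rewrite mul0r lexx.
  have : N%:R^-1 * \sum_i r i <= eps * t by lra.
  by rewrite ler_pdivrMl// mulrCA mulrA.
exists z, r, t; split; first by split=> // i; rewrite le_max lexx.
split=> //= [i|i p].
  apply: le_trans (tr i) _; rewrite /z; case: (leP (f (xi i)) 0) => fi.
    by rewrite subrr mulr0.
  (* A positive distance equals some normalized slack, which [M] dominates. *)
  rewrite subr0 mulr1 /f.
  have [p ->] := unsafe_distE (nrm := nrm) b e p0 (xi i).
  rewrite ge_max ltW//=; apply: le_trans (hM1 x i p Xx).
  by rewrite ler_pM2r ?invr_gt0// /e addrA ler_norm.
apply: le_trans (tr i) _.
have := unsafe_dist_le (nrm := nrm) b e p0 (xi i) p; rewrite -/f /e addrA.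
rewrite /z; case: (leP (f (xi i)) 0) => fi fg; last first.
  rewrite mulr0 addr0; move: fg; rewrite le_max => /orP[|//].
  by rewrite leNgt fi.
(* For [z i = 1] the sample cancels, leaving [d p - dotp (a p) x - q p] over the dual norm. *)
apply: le_trans fi _; rewrite mulr1 -mulrDl divr_ge0 ?(ltW (B0 p))//.
(* A sample whose value exceeds [d p - dotp (a p) x] has negative slack [p], hence is flagged; there
   are at most [k] of these. *)
have : q p <= d p - dotp (a p) x.
  rewrite hq; apply: nth_largest_le => //; apply: leq_trans zk.
  apply: leq_sum => j _; case: ltP => //= ej; rewrite /z.
  have -> // : f (xi j) <= 0.
  apply: le_trans (unsafe_dist_le (nrm := nrm) b e p0 (xi j) p) _.
  rewrite ge_max lexx/= pmulr_lle0 ?invr_gt0// /e; lra.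
lra.
Qed.
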